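(* Let $(P_t)_{t\ge0}$ be a measurable Markovian transition function on a measurable space $(E,\mathcal{B})$ and $m$ a finite positive measure on $(E,\mathcal{B})$ such that $m(f)=0$ implies $m(P_tf)=0$ for all $t>0$ and all positive measurable $f$. Let $R_\alpha f(x)=\int_0^\infty e^{-\alpha t}P_tf(x)\,dt$ be the associated resolvent. The following are equivalent: (i) there exists an invariant measure for $(P_t)_{t\ge0}$ absolutely continuous with respect to $m$; (ii) $m$ is resolvent almost invariant; (iii) there exists a sequence $\alpha_n\searrow0$ such that $c((R_\alpha)_{\alpha>0},m,(\alpha_n)_n)<m(E)$.
   Context: An invariant measure is a nonzero finite positive measure $\nu$ with $\int P_tf\,d\nu=\int f\,d\nu$ for all $t>0$ and bounded measurable $f$. $m$ is resolvent almost invariant if there exist $\delta\in[0,1)$ and $\phi:\mathcal{B}\to[0,\infty)$ with $\lim_{m(A)\to0}\phi(A)=0$ such that $m(\alpha R_\alpha1_A)\le\phi(A)+\delta m(E)$ for all $A\in\mathcal{B}$ and $\alpha>0$. For $\alpha_n\searrow0$, $$c((R_\alpha)_{\alpha>0},m,(\alpha_n)_n):=\lim_{\varepsilon\searrow0}\ \sup_{A\in\mathcal{B},\,m(A)<\varepsilon}\ \sup_n\ m(\alpha_nR_{\alpha_n}1_A).$$ *)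

(* Defs.v *)
From HB Require Import structures.
From mathcomp Require Import all_boot all_order all_algebra.
From mathcomp Require Import all_classical all_reals all_analysis.
From mathcomp Require Import measurable_realfun.
Set Implicit Arguments. Unset Strict Implicit. Unset Printing Implicit Defensive.
Import Order.TTheory GRing.Theory Num.Theory.
Import numFieldNormedType.Exports.
Local Open Scope classical_set_scope.
Local Open Scope ring_scope.
Local Open Scope ereal_scope.

Section defs.
Context (d : measure_display) (T : measurableType d) (R : realType).

Definition markov_transition_function (P : R -> T -> probability T R) : Prop :=
  (forall A : set T, measurable A ->
     measurable_fun ((`[0%R, +oo[%classic `*` [set: T]) : set (R * T)%type) ((fun p : R * T => P p.1 p.2 A) : (R * T)%type -> \bar R))
  /\ (forall (s t : R) (x : T) (A : set T), (0 <= s)%R -> (0 <= t)%R -> measurable A ->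
       P (s + t)%R x A = \int[P s x]_y P t y A).

Definition Pt (P : R -> T -> probability T R) (t : R) (f : T -> \bar R) (x : T)
  : \bar R := \int[P t x]_y f y.

Definition resolvent_ind (P : R -> T -> probability T R) (alpha : R) (A : set T)
    (x : T) : \bar R :=
  \int[lebesgue_measure]_(t in `[0%R, +oo[%classic)
      ((expR (- (alpha * t)))%:E * Pt P t (fun y => (\1_A y)%:E) x).

Definition m_aR (P : R -> T -> probability T R) (m : set T -> \bar R)
    (alpha : R) (A : set T) : \bar R :=
  \int[m]_x (alpha%:E * resolvent_ind P alpha A x).

Definition invariant_measure (P : R -> T -> probability T R)
    (nu : {finite_measure set T -> \bar R}) : Prop :=
  nu setT != 0 /\
  forall (t : R) (f : T -> R), (0 < t)%R -> measurable_fun setT f ->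
    (exists M : R, forall x, (`|f x| <= M)%R) ->
    \int[nu]_x Pt P t (fun y => (f y)%:E) x = \int[nu]_x (f x)%:E.

Definition resolvent_almost_invariant (P : R -> T -> probability T R)
    (m : set T -> \bar R) : Prop :=
  exists (delta : R) (phi : set T -> R),
    [/\ (0 <= delta)%R, (delta < 1)%R,
        (forall A, measurable A -> (0 <= phi A)%R),
        (forall eps : R, (0 < eps)%R -> exists eta : R, (0 < eta)%R /\
            forall A, measurable A -> m A < eta%:E -> (phi A < eps)%R) &
        (forall (A : set T) (alpha : R), measurable A -> (0 < alpha)%R ->
           m_aR P m alpha A <= (phi A)%:E + delta%:E * m setT)].

Definition c_const (P : R -> T -> probability T R) (m : set T -> \bar R)
    (alpha : nat -> R) : \bar R :=
  lim ((fun eps : R =>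
          ereal_sup [set ereal_sup (range (fun n => m_aR P m (alpha n) A))
                    | A in [set A | measurable A /\ m A < eps%:E]])
       @ 0^'+).

End defs.

(* Main.v *)
Require Import Defs.
From HB Require Import structures.
From mathcomp Require Import all_boot all_order all_algebra.
From mathcomp Require Import all_classical all_reals all_analysis.
From mathcomp Require Import measurable_realfun.
From mathcomp Require Import ring lra.
Import Order.TTheory GRing.Theory Num.Theory.
Import numFieldNormedType.Exports.
Local Open Scope classical_set_scope.
Local Open Scope ring_scope.
Local Open Scope ereal_scope.

(* (i) => (ii): if nu = g m is invariant, then m (alpha R_alpha 1_A) <= nu(A) + m(1 - min(g, 1)), and
   the last term is < m(E) because g is not m-a.e. zero.
   (iii) => (i): let nu_n = m (alpha_n R_{alpha_n}) and let Lambda be the limit of the nu_n along a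
   free ultrafilter, a finitely additive set function.  The outer measure generated by Lambda
   restricts to the largest measure nu below Lambda; this replaces the Yosida-Hewitt decomposition.
   Since nu_n P_t <= exp(alpha_n t) nu_n, the measure nu P_t is again below Lambda, hence below nu,
   and equality of masses gives invariance.  If nu were zero, Lambda would be carried by sets of
   arbitrarily small m-measure, contradicting c < m(E). *)

(** * Composition of a measure with a kernel *)

Section measure_bind.
Set Implicit Arguments. Unset Strict Implicit.
Context d1 d2 (X : measurableType d1) (Y : measurableType d2) (R : realType).
Variables (mu : {measure set X -> \bar R}) (k : X -> {measure set Y -> \bar R}).

(** The composite measure [mu k]. The measurability proof is an argument so that the measure
    structure can be attached to the term [mbind mk]. *)
Definition mbind (mk : forall U, measurable U -> measurable_fun [set: X] (k ^~ U))
  (U : set Y) : \bar R := \int[mu]_x k x U.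

Hypothesis mk : forall U, measurable U -> measurable_fun [set: X] (k ^~ U).

Let mbind0 : mbind mk set0 = 0.
Proof. by rewrite /mbind (eq_integral (cst 0)) ?integral0// => x _; rewrite measure0. Qed.

Let mbind_ge0 U : 0 <= mbind mk U.
Proof. exact: integral_ge0. Qed.

Let mbind_sigma_additive : semi_sigma_additive (mbind mk).
Proof.
move=> U mU tU mUU; rewrite [X in _ --> X](_ : _ =
  \int[mu]_x (\sum_(n <oo) k x (U n))); last first.
  apply: eq_integral => x _.
  by apply/esym/cvg_lim => //; exact/measure_semi_sigma_additive.
apply/cvg_closeP; split.
  by apply: is_cvg_nneseries => n _ _; exact: integral_ge0.
by rewrite closeE// integral_nneseries// => n; exact: mk.
Qed.

HB.instance Definition _ := isMeasure.Build _ _ R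
  (mbind mk) mbind0 mbind_ge0 mbind_sigma_additive.

Import HBNNSimple.

Let integral_mbind_nnsfun (f : {nnsfun Y >-> R}) :
  \int[mbind mk]_y (f y)%:E = \int[mu]_x (\int[k x]_y (f y)%:E).
Proof.
under [RHS]eq_integral do rewrite integralT_nnsfun sintegralE.
rewrite integralT_nnsfun sintegralE ge0_integral_fsum//; last 2 first.
- by move=> r; apply: measurable_funeM; exact: mk.
- move=> r x _; have [r0|r0] := leP 0%R r; first by rewrite mule_ge0// lee_fin.
  by rewrite preimage_nnfun0// measure0 mule0.
apply: eq_fsbigr => r _; have [r0|r0] := leP 0%R r.
  by rewrite ge0_integralZl// ?lee_fin//; exact: mk.
rewrite preimage_nnfun0// measure0 mule0 integral0_eq// => x _.
by rewrite measure0 mule0.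
Qed.

(** The formula for simple functions extends by monotone convergence, used under [mbind mk], under
    each [k x], and under [mu]. *)
Lemma ge0_integral_mbind (f : Y -> \bar R) :
  (forall y, 0 <= f y) -> measurable_fun [set: Y] f ->
  \int[mbind mk]_y f y = \int[mu]_x (\int[k x]_y f y).
Proof.
move=> f0 mf; pose g := nnsfun_approx measurableT mf.
have intE (la : {measure set Y -> \bar R}) :
    \int[la]_y f y = limn (fun n => \int[la]_y (g n y)%:E).
  rewrite -monotone_convergence//.
  - by apply: eq_integral => y _; apply/esym/cvg_lim => //; exact: cvg_nnsfun_approx.
  - by move=> n; exact/measurable_EFinP.
  - by move=> n y _; rewrite lee_fin.
  - by move=> y _ a b ab; rewrite lee_fin; exact/lefP/nd_nnsfun_approx.
rewrite intE; under eq_fun do rewrite integral_mbind_nnsfun.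
rewrite -monotone_convergence//.
- by apply: eq_integral => x _; rewrite intE.
- move=> n; apply: measurable_fun_integral_kernel => //.
  + by move=> z; rewrite lee_fin.
  + exact/measurable_EFinP.
- by move=> n x _; apply: integral_ge0 => y _; rewrite lee_fin.
- move=> x _ a b ab; apply: ge0_le_integral => //.
  + by move=> y _; rewrite lee_fin.
  + exact/measurable_EFinP.
  + exact/measurable_EFinP.
  + by move=> y _; rewrite lee_fin; exact/lefP/nd_nnsfun_approx.
Qed.

End measure_bind.

(** * Translation invariance of Lebesgue measure *)

Section translation.
Context (R : realType).
Local Notation leb := (@lebesgue_measure R).

(** The pushforward gives every half-open interval its length, and this property determines Lebesgue
    measure. *)
Lemma lebesgue_measure_shift (t : R) (A : set (measurableTypeR R)) :
  measurable A ->
  leb A = pushforward leb ((fun x : R => x + t)%R : measurableTypeR R -> measurableTypeR R) A.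
Proof.
have mt : measurable_fun setT
    ((fun x : R => x + t)%R : measurableTypeR R -> measurableTypeR R).
  exact: measurable_funD.
pose mt' := isMeasurableFun.Build _ _ _ _ _ mt.
pose st : {mfun measurableTypeR R >-> measurableTypeR R} :=
  HB.pack ((fun x : R => x + t)%R : measurableTypeR R -> measurableTypeR R) mt'.
move=> mA.
apply: (@lebesgue_measure_unique R (pushforward leb st) _ A mA) => _ [[a b] _ <-] /=.
rewrite /pushforward.
have -> : (fun x : R => (x + t)%R) @^-1` `]a, b] = `](a - t)%R, (b - t)%R]%classic.
  by apply/seteqP; split=> x /=; rewrite !in_itv/= ltrBlDr lerBrDr.
rewrite !lebesgue_measure_itv/= !lte_fin ltrD2r.
by case: ifP => // _; rewrite -!EFinD; congr EFin; rewrite opprB addrA subrK.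
Qed.

Lemma ge0_integral_shift (t : R) (f : R -> \bar R) :
  (forall x, 0 <= f x) -> measurable_fun setT f ->
  \int[leb]_x f (x + t)%R = \int[leb]_x f x.
Proof.
move=> f0 mf.
have mt : measurable_fun setT
    ((fun x : R => x + t)%R : measurableTypeR R -> measurableTypeR R).
  exact: measurable_funD.
pose mt' := isMeasurableFun.Build _ _ _ _ _ mt.
pose st : {mfun measurableTypeR R >-> measurableTypeR R} :=
  HB.pack ((fun x : R => x + t)%R : measurableTypeR R -> measurableTypeR R) mt'.
rewrite [RHS](_ : _ = \int[pushforward leb st]_x f x).
  by rewrite (@ge0_integral_pushforward _ _ _ _ _ st mt leb setT f)// preimage_setT.
by apply: eq_measure_integral => A mA _; exact: lebesgue_measure_shift.
Qed.

End translation.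

(** Compactness of [[0, M]] gives a cluster point [p]. For a neighbourhood [V] of [p] the
    ultrafilter contains the preimage of [V] or that of its complement, and the latter cannot happen
    at a cluster point. *)
Lemma ultrafilter_bounded_cvg (R : realType) (G : set_system nat) (u : nat -> R) (M : R) :
  UltraFilter G -> (forall n, 0 <= u n <= M)%R -> cvg (u @ G).
Proof.
move=> UG u0M.
have [p [_ Gp]] : `[0%R, M]%classic `&` cluster (u @ G) !=set0.
  apply: (@segment_compact R 0%R M (u @ G)).
  by apply: nearW => n /=; rewrite in_itv/= u0M.
apply/cvg_ex; exists p => V Vp.
have [//|GV] := in_ultra_setVsetC (u @^-1` V) UG.
have [x [xV Vx]] := Gp (~` V) V GV Vp.
by [].
Qed.

(** * The largest measure below a finitely additive content *)

Section largest_measure_below_content.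
Set Implicit Arguments. Unset Strict Implicit.
Context d (T : measurableType d) (R : realType).
Variable mu : {content set T -> \bar R}.
Local Open Scope measure_scope.

(** The set itself, followed by empty sets, is one of the admissible covers. *)
Lemma mu_ext_content_le A : measurable A -> mu^* A <= mu A.
Proof.
move=> mA; apply: ereal_inf_lbound; exists (fun n => if n is 0%N then A else set0).
  split; first by case.
  by move=> x Ax; exists 0%N.
rewrite nneseries_recl//.
rewrite eseries_cond/= eseries0 ?adde0// => -[|]//= k _ _.
Qed.

(** Cutting each member of a cover of [X] along [A] yields covers of the two pieces of [X]. Only
    finite additivity of [mu] is used, so this works for contents. *)
Lemma mu_ext_content_caratheodory A : measurable A -> mu^*.-caratheodory A.
Proof.
move=> mA; apply: le_caratheodory_measurable => X.
apply: le_ereal_inf_tmp => _ [B [mB XB] <-].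
rewrite [leRHS](_ : _ = \sum_(k <oo) (mu (B k `&` A) + mu (B k `&` ~` A))); last first.
  apply: eq_eseriesr => k _; rewrite -measure_semi_additive2//.
  - by rewrite -setIUr setUCr setIT.
  - exact: measurableI.
  - exact: measurableI (mB k) (measurableC mA).
  - rewrite -setIUr setUCr setIT; exact: mB.
  - by rewrite setIACA setICr setI0.
rewrite nneseriesD//; apply: leeD; apply: ereal_inf_lbound.
- exists (fun k => B k `&` A) => //; split=> [i|]; first exact: measurableI.
  by rewrite -setI_bigcupl; exact: setSI.
- exists (fun k => B k `&` ~` A) => //; split=> [i|].
    exact: measurableI (mB i) (measurableC mA).
  by rewrite -setI_bigcupl; exact: setSI.
Qed.

(** On measurable sets this is the countably additive part of [mu]: a measure below [mu] that
    dominates every other such measure. *)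
Definition lower_measure : set T -> \bar R := mu^*.

Let lower_measure0 : lower_measure set0 = 0.
Proof. exact: mu_ext0. Qed.

Let lower_measure_ge0 A : 0 <= lower_measure A.
Proof. exact: mu_ext_ge0. Qed.

Let lower_measure_sigma_additive : semi_sigma_additive lower_measure.
Proof.
move=> F mF tF mUF.
apply: (@caratheodory_measure_sigma_additive R T mu^*) => //.
  by move=> i; exact: mu_ext_content_caratheodory.
exact: mu_ext_content_caratheodory.
Qed.

HB.instance Definition _ := isMeasure.Build _ _ R
  lower_measure lower_measure0 lower_measure_ge0 lower_measure_sigma_additive.

Lemma lower_measure_le A : measurable A -> lower_measure A <= mu A.
Proof. exact: mu_ext_content_le. Qed.

(** For any countable cover of [A], subadditivity of [la] bounds [la A] by the sum of the
    [mu]-values; then take the infimum over covers. *)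
Lemma lower_measure_max (la : {measure set T -> \bar R}) :
  (forall A, measurable A -> la A <= mu A) ->
  forall A, measurable A -> la A <= lower_measure A.
Proof.
move=> lamu A mA; apply: le_ereal_inf_tmp => _ [B [mB AB] <-].
apply: (@le_trans _ _ (\sum_(k <oo) la (B k))).
  exact: measure_sigma_subadditive.
by apply: lee_nneseries => // k _; exact: lamu.
Qed.

Lemma lower_measure_eq0 A : measurable A -> mu A = 0 -> lower_measure A = 0.
Proof.
move=> mA muA0; apply/eqP; rewrite eq_le measure_ge0 andbT -muA0.
exact: lower_measure_le.
Qed.

(* The unions of the first [n] sets of an almost optimal cover of the whole space exhaust it. *)
Lemma lower_measure_null_exhaust (e : R) : lower_measure setT = 0 -> (0 < e)%R ->
  exists B : (set T)^nat, [/\ (forall n, measurable (B n)), nondecreasing_seq B,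
    \bigcup_n B n = setT & forall n, mu (B n) <= e%:E].
Proof.
move=> mu0 e0.
have : ereal_inf [set \sum_(k <oo) mu (A k) | A in measurable_cover [set: T]] < e%:E.
  by rewrite -[X in X < _]/(lower_measure setT) mu0 lte_fin.
move=> /ereal_inf_lt[_ [A [mA TA] <-] Ae].
exists (fun n => \big[setU/set0]_(i < n) A i); split.
- by move=> n; exact: bigsetU_measurable.
- by move=> a b ab; apply/subsetPset; exact: subset_bigsetU.
- by apply/seteqP; split=> // x /TA[n _ Anx]; exists n.+1 => //; rewrite big_ord_recr; right.
- move=> n; apply: le_trans (ltW Ae).
  apply: (@le_trans _ _ (\sum_(k < n) mu (A k))).
    apply: content_subadditive => //; exact: bigsetU_measurable.
  rewrite -(big_mkord xpredT (mu \o A)).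
  by apply: nneseries_lim_ge => k _ _; exact: measure_ge0.
Qed.

End largest_measure_below_content.

(** * The measure [m (alpha R_alpha)] and its behaviour under the transition function *)

Section resolvent_measure.
Set Implicit Arguments. Unset Strict Implicit.
Context d (T : measurableType d) (R : realType).
Variable P : R -> T -> probability T R.
Hypothesis HP : markov_transition_function P.
Local Notation leb := (@lebesgue_measure R).

(* [P t] is only controlled for [0 <= t]; truncating time at [0] gives a kernel on all of [R * T]. *)
Definition trunc_kernel (p : measurableTypeR R * T) : probability T R :=
  P (Num.max 0%R p.1) p.2.

Lemma trunc_kernelE s x : (0 <= s)%R -> trunc_kernel (s, x) = P s x.
Proof. by move=> s0; rewrite /trunc_kernel/= max_r. Qed.

Lemma measurable_trunc_kernel A : measurable A ->
  measurable_fun setT (trunc_kernel ^~ A).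
Proof.
move=> mA; have := HP.1 A mA.
move=> /(@measurable_comp _ _ _ _ _ _ ((`[0%R, +oo[%classic `*` [set: T]) : set (R * T)%type) _ setT
  (fun p : measurableTypeR R * T => (Num.max 0%R p.1, p.2) : (measurableTypeR R * T)%type)).
apply.
- by apply: measurableX => //; exact: measurable_itv.
- by move=> _ [[s x] _ <-]; split=> //=; rewrite in_itv/= le_max lexx.
- apply/measurable_fun_pairP; split => /=.
    exact: measurable_maxr.
  exact: measurable_snd.
Qed.

Lemma measurable_transition t A : (0 <= t)%R -> measurable A ->
  measurable_fun setT (fun x => P t x A).
Proof.
move=> t0 mA; rewrite (_ : (fun x => _) = (fun x => trunc_kernel (t, x) A)).
  exact: (measurable_fun_pair2 t (measurable_trunc_kernel mA)).
by apply/funext => x; rewrite trunc_kernelE.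
Qed.

Let measurable_trunc_time x A : measurable A ->
  measurable_fun setT (fun s : measurableTypeR R => trunc_kernel (s, x) A).
Proof. by move=> mA; exact: (measurable_fun_pair1 x (measurable_trunc_kernel mA)). Qed.

Let measurable_trunc_space s A : measurable A ->
  measurable_fun setT (fun x => trunc_kernel (s, x) A).
Proof. by move=> mA; exact: (measurable_fun_pair2 s (measurable_trunc_kernel mA)). Qed.

Variables (alpha : R) (alpha_gt0 : (0 < alpha)%R).
Local Notation pdf := (exponential_pdf alpha).

Let pdf_ge0 s : (0 <= pdf s)%R.
Proof. exact: exponential_pdf_ge0 (ltW alpha_gt0) s. Qed.

Let mpdf : measurable_fun [set: measurableTypeR R] (EFin \o pdf).
Proof. by apply/measurable_EFinP; exact: measurable_exponential_pdf. Qed.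

Definition weighted_kernel (x : T) (s : measurableTypeR R) : {measure set T -> \bar R} :=
  mscale (NngNum (pdf_ge0 s)) (trunc_kernel (s, x)).

Let measurable_weighted_pair (f : T -> \bar R) :
  (forall y, 0 <= f y) -> measurable_fun setT f ->
  measurable_fun [set: measurableTypeR R * T]
    (fun p => (pdf p.1)%:E * \int[trunc_kernel p]_y f y).
Proof.
move=> f0 mf; apply: emeasurable_funM.
  exact: (measurableT_comp mpdf measurable_fst).
by apply: measurable_fun_integral_kernel => // U mU; exact: measurable_trunc_kernel.
Qed.

Lemma measurable_weighted_kernel x U : measurable U ->
  measurable_fun setT (weighted_kernel x ^~ U).
Proof.
move=> mU; rewrite /weighted_kernel /mscale/=; apply: emeasurable_funM => //.
exact: measurable_trunc_time.
Qed.

(** This is [alpha R_alpha (x, .)]. Since [pdf s] is [alpha * expR (- alpha * s)] for [s >= 0] and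
    zero before, it is the law of the process observed at an independent exponential time. *)
Definition resolvent_kernel (x : T) : {measure set T -> \bar R} :=
  mbind leb (measurable_weighted_kernel x).

Let integral_weighted x s (f : T -> \bar R) : (forall y, 0 <= f y) -> measurable_fun setT f ->
  \int[weighted_kernel x s]_y f y = (pdf s)%:E * \int[trunc_kernel (s, x)]_y f y.
Proof. by move=> f0 mf; rewrite ge0_integral_mscale. Qed.

Lemma integral_resolvent_kernel x (f : T -> \bar R) :
  (forall y, 0 <= f y) -> measurable_fun setT f ->
  \int[resolvent_kernel x]_y f y =
  \int[leb]_s ((pdf s)%:E * \int[trunc_kernel (s, x)]_y f y).
Proof.
move=> f0 mf; rewrite ge0_integral_mbind//.
by apply: eq_integral => s _; exact: integral_weighted.
Qed.

Lemma resolvent_kernelE x A : measurable A ->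
  resolvent_kernel x A = \int[leb]_s ((pdf s)%:E * trunc_kernel (s, x) A).
Proof. by []. Qed.

Lemma measurable_resolvent_kernel A : measurable A ->
  measurable_fun setT (resolvent_kernel ^~ A).
Proof.
move=> mA.
apply: (@measurable_fun_fubini_tonelli_G _ _ _ _ R leb
  (fun p => (pdf p.1)%:E * trunc_kernel p A)).
  apply: emeasurable_funM; first exact: (measurableT_comp mpdf measurable_fst).
  exact: measurable_trunc_kernel.
by move=> p; rewrite mule_ge0// lee_fin.
Qed.

Variable m : {finite_measure set T -> \bar R}.

(** The base measure is a parameter because the construction is applied both to the reference
    measure and to an invariant one. *)
Definition resolvent_measure : {measure set T -> \bar R} :=
  mbind m measurable_resolvent_kernel.

Lemma ge0_integral_resolvent_measure (f : T -> \bar R) :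
  (forall y, 0 <= f y) -> measurable_fun setT f ->
  \int[resolvent_measure]_y f y =
  \int[m]_x \int[leb]_s ((pdf s)%:E * \int[trunc_kernel (s, x)]_y f y).
Proof.
move=> f0 mf; rewrite ge0_integral_mbind//.
by apply: eq_integral => x _; exact: integral_resolvent_kernel.
Qed.

(** The factor [alpha] moves under the time integral to complete the exponential density, which
    vanishes off the half-line. *)
Lemma m_aR_resolvent_measure A : measurable A -> m_aR P m alpha A = resolvent_measure A.
Proof.
move=> mA; apply: eq_integral => x _; rewrite resolvent_kernelE//.
rewrite /resolvent_ind -ge0_integralZl//.
- rewrite [LHS]integral_mkcond; apply: eq_integral => s _.
  rewrite patchE; case: ifPn => [|s0].
    rewrite inE/= in_itv/= andbT => s0.
    rewrite trunc_kernelE// exponential_pdfE// /Pt integral_indic// setIT.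
    by rewrite muleA -EFinM mulNr.
  rewrite lt0_exponential_pdf ?mul0e//.
  by rewrite ltNge; apply: contra s0 => s0; rewrite inE/= in_itv/= s0.
- apply: emeasurable_funM.
    apply/measurable_EFinP; apply: measurable_funTS; apply: measurableT_comp => //.
    apply: measurableT_comp => //; exact: measurable_funM.
  apply: (eq_measurable_fun (fun s => trunc_kernel (s, x) A)).
    move=> s; rewrite inE/= in_itv/= andbT => s0.
    by rewrite /Pt integral_indic// setIT trunc_kernelE.
  by apply: measurable_funTS; exact: measurable_trunc_time.
- move=> s _; apply: mule_ge0; first by rewrite lee_fin expR_ge0.
  by apply: integral_ge0 => y _; rewrite lee_fin.
- by rewrite lee_fin ltW.
Qed.

Lemma resolvent_measureT : resolvent_measure setT = m setT.
Proof.
rewrite -[RHS]mul1e -integral_cst//; apply: eq_integral => x _.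
rewrite resolvent_kernelE// -(integral_exponential_pdf alpha_gt0).
by apply: eq_integral => s _; rewrite probability_setT mule1.
Qed.

(** Tonelli puts the time integral outside, so that facts known at each fixed time can be
    inserted. *)
Lemma resolvent_measure_fubini A : measurable A ->
  resolvent_measure A = \int[leb]_s ((pdf s)%:E * \int[m]_x trunc_kernel (s, x) A).
Proof.
move=> mA.
rewrite -[LHS](@fubini_tonelli _ _ _ _ R leb m
  (fun p => (pdf p.1)%:E * trunc_kernel p A)); last 2 first.
- apply: emeasurable_funM; first exact: (measurableT_comp mpdf measurable_fst).
  exact: measurable_trunc_kernel.
- by move=> p; rewrite mule_ge0// lee_fin.
apply: eq_integral => s _ /=; rewrite ge0_integralZl//.
- exact: measurable_trunc_space.
- by rewrite lee_fin.
Qed.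

(* Time [0] is Lebesgue-null, so nothing is needed about [P 0], which need not be the identity. *)
Lemma resolvent_measure_cst (c : \bar R) A : measurable A -> 0 <= c ->
  (forall t, (0 < t)%R -> \int[m]_x P t x A = c) -> resolvent_measure A = c.
Proof.
move=> mA c0 Hc; rewrite resolvent_measure_fubini//.
have mF : measurable_fun setT (fun s : measurableTypeR R => \int[m]_x trunc_kernel (s, x) A).
  exact: (measurable_fun_fubini_tonelli_F (fun p => trunc_kernel p A) (measurable_trunc_kernel mA)).
have split0 (f : R -> \bar R) : measurable_fun setT f -> (forall s, 0 <= f s) ->
    (forall s, (s < 0)%R -> f s = 0) ->
    \int[leb]_s f s = \int[leb]_(s in `]0%R, +oo[) f s.
  move=> mf f0 fn.
  rewrite [RHS]integral_itv_obnd_cbnd//; last exact: measurable_funTS.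
  rewrite [RHS]integral_mkcond; apply: eq_integral => s _.
  rewrite patchE; case: ifPn => // s0; apply: fn.
  by rewrite ltNge; apply: contra s0 => s0; rewrite inE/= in_itv/= s0.
rewrite split0.
- transitivity (\int[leb]_(s in `]0%R, +oo[) ((pdf s)%:E * c)).
    apply: eq_integral => s; rewrite inE/= in_itv/= andbT => s0; congr (_ * _).
    by rewrite -(Hc s s0); apply: eq_integral => x _; rewrite trunc_kernelE// ltW.
  rewrite -split0.
  + rewrite ge0_integralZr//; last by move=> s _; rewrite lee_fin.
    by rewrite (integral_exponential_pdf alpha_gt0) mul1e.
  + exact: emeasurable_funM.
  + by move=> s; rewrite mule_ge0// lee_fin.
  + by move=> s s0; rewrite lt0_exponential_pdf// mul0e.
- exact: emeasurable_funM.
- by move=> s; rewrite mule_ge0 ?lee_fin// integral_ge0.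
- by move=> s s0; rewrite lt0_exponential_pdf// mul0e.
Qed.

(** Applying [P t] delays the exponential time by [t], and the delayed density is at most
    [expR (alpha * t)] times the original one. As [alpha] tends to [0] this becomes
    subinvariance. *)
Lemma integral_transition_resolvent_le t A : (0 <= t)%R -> measurable A ->
  \int[resolvent_measure]_y P t y A <= (expR (alpha * t))%:E * resolvent_measure A.
Proof.
move=> t0 mA; rewrite ge0_integral_resolvent_measure//; last exact: measurable_transition.
have mg : measurable_fun setT (fun p : measurableTypeR R * T =>
    (pdf p.1)%:E * trunc_kernel p A).
  apply: emeasurable_funM; first exact: (measurableT_comp mpdf measurable_fst).
  exact: measurable_trunc_kernel.
have mQ x := @measurable_trunc_time x A mA.
rewrite [leRHS](_ : _ = \int[m]_x ((expR (alpha * t))%:E * resolvent_kernel x A)); last first.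
  rewrite ge0_integralZl// ?lee_fin ?expR_ge0//.
  exact: measurable_resolvent_kernel.
apply: ge0_le_integral => //.
- by move=> x _; apply: integral_ge0 => s _; rewrite mule_ge0 ?lee_fin// integral_ge0.
- apply: (@measurable_fun_fubini_tonelli_G _ _ _ _ R leb
    (fun p => (pdf p.1)%:E * \int[trunc_kernel p]_y P t y A)).
    by apply: measurable_weighted_pair => //; exact: measurable_transition.
  by move=> p; rewrite mule_ge0 ?lee_fin// integral_ge0.
- by apply: measurable_funeM; exact: measurable_resolvent_kernel.
have mQpdf x : measurable_fun setT
    (fun s : measurableTypeR R => (pdf s)%:E * trunc_kernel (s, x) A).
  exact: emeasurable_funM.
have Qpdf0 x s : 0 <= (pdf s)%:E * trunc_kernel (s, x) A.
  by rewrite mule_ge0// lee_fin.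
move=> x _; rewrite resolvent_kernelE//.
rewrite [leRHS](_ : _ = \int[leb]_s
    ((expR (alpha * t))%:E * ((pdf s)%:E * trunc_kernel (s, x) A))); last first.
  by rewrite ge0_integralZl// lee_fin expR_ge0.
(* Chapman-Kolmogorov makes the integrand a function of [s + t], ready for translation. For [s < 0]
   the density is zero, so the truncation of time does no harm. *)
rewrite [leLHS](_ : _ = \int[leb]_s ((pdf ((s + t) - t)%R)%:E * trunc_kernel ((s + t)%R, x) A)); last first.
  apply: eq_integral => s _; rewrite addrK; have [s0|s0] := ltP s 0%R.
    by rewrite lt0_exponential_pdf// !mul0e.
  by rewrite !trunc_kernelE ?addr_ge0// HP.2.
have mpdft : measurable_fun [set: measurableTypeR R] (fun s => (pdf (s - t)%R)%:E).
  apply: (measurableT_comp mpdf); exact: measurable_funB.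
rewrite (@ge0_integral_shift R t (fun s => (pdf (s - t)%R)%:E * trunc_kernel (s, x) A)); last 2 first.
- by move=> s; rewrite mule_ge0// lee_fin.
- exact: (emeasurable_funM mpdft (mQ x)).
apply: ge0_le_integral => //.
- by move=> s _; rewrite mule_ge0// lee_fin.
- exact: (emeasurable_funM mpdft (mQ x)).
- apply: measurable_funeM; exact: emeasurable_funM.
move=> s _; rewrite muleA lee_wpmul2r// -EFinM lee_fin.
(* Before time [t] the shifted density is zero; from [t] on it equals [expR (alpha * t)] times
   [pdf s]. *)
have [st|st] := ltP (s - t)%R 0%R.
  by rewrite lt0_exponential_pdf// mulr_ge0// expR_ge0.
rewrite !exponential_pdfE//; last by rewrite (le_trans t0)// -subr_ge0.
rewrite [leRHS]mulrCA -expRD.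
by rewrite (_ : alpha * t + - alpha * s = - alpha * (s - t))%R//; ring.
Qed.

End resolvent_measure.

(** * Ultrafilter limits of measures of equal mass *)

Section ultrafilter_limit_content.
Set Implicit Arguments. Unset Strict Implicit.
Context d (T : measurableType d) (R : realType).
Variables (nu : nat -> {measure set T -> \bar R}) (M : R).
Hypothesis nuT : forall n, nu n setT = M%:E.
Variables (G : set_system nat) (UG : UltraFilter G).

Let nu_le n A : measurable A -> nu n A <= M%:E.
Proof. by move=> mA; rewrite -(nuT n) le_measure// inE. Qed.

Let nu_fin n A : measurable A -> nu n A \is a fin_num.
Proof.
by move=> mA; rewrite ge0_fin_numE// (le_lt_trans (nu_le n mA))// ltry.
Qed.

(* The absolute value matters only for non-measurable sets, on which the limit may be junk. *)
Definition limit_content of (forall n, nu n setT = M%:E) & UltraFilter G :=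
  fun A : set T => (`|lim ((fun n => fine (nu n A)) @ G)|%R)%:E : \bar R.

Local Notation lambda := (limit_content nuT UG).

(** The values lie in [[0, M]], so they converge along [G]; the limit is nonnegative and the
    absolute value leaves it unchanged. *)
Lemma limit_content_cvg A : measurable A -> nu n A @[n --> G] --> lambda A.
Proof.
move=> mA.
have cu : cvg ((fun n => fine (nu n A)) @ G).
  apply: (@ultrafilter_bounded_cvg R G _ M UG) => n.
  by rewrite fine_ge0//= -lee_fin fineK ?nu_fin// nu_le.
rewrite /limit_content ger0_norm; last first.
  by apply: limr_ge => //; apply: nearW => n; exact: fine_ge0.
by apply: cvg_EFin => //; apply: nearW => n; exact: nu_fin.
Qed.

Let limit_content_ge0 A : 0 <= lambda A.
Proof. by rewrite lee_fin. Qed.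

Lemma limit_content_unique A l : measurable A -> nu n A @[n --> G] --> l ->
  lambda A = l.
Proof.
move=> mA nl; exact: (cvg_unique _ (limit_content_cvg mA) nl).
Qed.

Let limit_content_additive : measure_function.semi_additive lambda.
Proof.
apply/additive2P.
  apply: limit_content_unique => //.
  by under eq_fun do rewrite measure0; exact: cvg_cst.
move=> A B mA mB AB0; apply: limit_content_unique; first exact: measurableU.
under eq_fun do rewrite measureU//.
by apply: cvgeD => //; exact: limit_content_cvg.
Qed.

HB.instance Definition _ := isContent.Build _ T R lambda
  limit_content_ge0 limit_content_additive.

Lemma limit_contentT : lambda setT = M%:E.
Proof.
apply: limit_content_unique => //.
by under eq_fun do rewrite nuT; exact: cvg_cst.
Qed.

Lemma limit_content_le A c : measurable A -> (forall n, nu n A <= c) ->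
  lambda A <= c.
Proof. by move=> mA nc; apply: (cvge_to_le (limit_content_cvg mA)); exact: nearW. Qed.

Import HBNNSimple.

(** The limit content need not be countably additive, so the limit is taken on simple functions
    [h <= f], whose integrals are finite sums. Each such sum is the limit of integrals bounded by
    [b n]. *)
Lemma integral_lower_measure_le (f : T -> \bar R) (b : nat -> \bar R) (l : \bar R) :
  (forall x, 0 <= f x) -> measurable_fun setT f ->
  (forall n, \int[nu n]_x f x <= b n) -> b n @[n --> G] --> l ->
  \int[lower_measure lambda]_x f x <= l.
Proof.
move=> f0 mf fb bl; rewrite ge0_integralTE//; apply: ge_ereal_sup => _ [h hf <-].
apply: (@le_trans _ _ (\sum_(r \in range h) (r%:E * lambda (h @^-1` [set r])))).
  rewrite sintegralE lee_fsum// => r [x _ <-].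
  by rewrite lee_wpmul2l ?lee_fin//; exact: lower_measure_le.
have hl : sintegral (nu n) h @[n --> G] -->
    \sum_(r \in range h) (r%:E * lambda (h @^-1` [set r])).
  under eq_fun do rewrite sintegralE fsbig_finite// big_seq.
  rewrite fsbig_finite// big_seq; apply: cvg_nnesum => r.
    rewrite in_fset_set// inE => -[x _ <-]; apply: nearW => n.
    by rewrite mule_ge0// lee_fin.
  by move=> _; apply: cvgeZl => //; exact: limit_content_cvg.
apply: (lee_cvg_to hl bl); apply: nearW => n.
apply: le_trans (fb n); rewrite ge0_integralTE//.
by apply: ereal_sup_ubound; exists h.
Qed.

Variable m : {finite_measure set T -> \bar R}.

Lemma lower_measure_dominates :
  (forall n A, measurable A -> m A = 0 -> nu n A = 0) ->
  lower_measure lambda `<< m.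
Proof.
move=> nu0; apply/null_content_dominatesP => A mA mA0.
apply: lower_measure_eq0 => //; apply: limit_content_unique => //.
by under eq_fun do rewrite nu0//; exact: cvg_cst.
Qed.

(* If the lower measure vanished, the limit content would live on sets of arbitrarily small
   [m]-measure, so the [nu n] would concentrate all of their mass there. *)
Lemma lower_measure_neq0 (c eps : R) : (0 < eps)%R -> (c < M)%R ->
  (forall n A, measurable A -> m A < eps%:E -> nu n A <= c%:E) ->
  lower_measure lambda setT != 0.
Proof.
move=> eps0 cM nuc; apply/eqP => L0.
(* Half of the gap leaves [c + (M - c) / 2 < M], which contradicts the total mass of the limit
   content. *)
have e0 : (0 < (M - c) / 2)%R by rewrite divr_gt0// subr_gt0.
have [B [mB ndB BT LB]] := lower_measure_null_exhaust L0 e0.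
(* The complements of the [B n] decrease to the empty set and [m] is finite, so one of them has
   measure below [eps], where the bound [c] applies. *)
have : m (~` B n) @[n --> \oo] --> 0.
  rewrite -(@measure0 _ _ _ m) -setCT -BT setC_bigcup.
  apply: nonincreasing_cvg_mu => //.
  - by rewrite -ge0_fin_numE// fin_num_measure//; exact: measurableC.
  - by move=> n; exact: measurableC.
  - by apply: bigcap_measurable => // n _; exact: measurableC.
  - by move=> a b ab; apply/subsetPset/subsetC/subsetPset/ndB.
move=> /(_ [set x | x < eps%:E])[].
  by apply: open_nbhs_nbhs; split; [exact: open_ereal_lt_ereal|rewrite /= lte_fin].
move=> N _ /(_ N (leqnn N)) mBN.
have : M%:E <= c%:E + ((M - c) / 2)%:E.
  rewrite -limit_contentT -(setUCl (B N)) measureU//; first last.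
  - by rewrite setICl.
  - exact: measurableC.
  apply: leeD => //; apply: limit_content_le; first exact: measurableC.
  by move=> n; apply: nuc => //; exact: measurableC.
by rewrite -EFinD lee_fin; lra.
Qed.

End ultrafilter_limit_content.

(** * Invariance, resolvent almost invariance and the constant [c] *)

Section invariant_measures.
Set Implicit Arguments. Unset Strict Implicit.
Context d (T : measurableType d) (R : realType).
Variables (P : R -> T -> probability T R) (m : {finite_measure set T -> \bar R}).
Hypothesis HP : markov_transition_function P.
Hypothesis m_gt0 : 0 < m setT.

Local Notation c_sup alpha := (fun eps : R =>
  ereal_sup [set ereal_sup (range (fun n => m_aR P m (alpha n) A))
            | A in [set A | measurable A /\ m A < eps%:E]]).

(** The supremum is nondecreasing in [eps], so its right limit at [0] is an infimum. *)
Lemma c_constE alpha :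
  c_const P m alpha = ereal_inf (c_sup alpha @` [set eps | (0 < eps)%R]).
Proof.
have -> : [set eps : R | (0 < eps)%R] = [set` `]0%R, +oo[].
  by apply/seteqP; split=> x /=; rewrite in_itv/= andbT.
apply/cvg_lim => //; apply: nondecreasing_at_right_cvge => //.
move=> a b _ _ ab; apply: le_ereal_sup => _ [A [mA Aa] <-].
by exists A => //; split=> //; rewrite (lt_le_trans Aa)// lee_fin.
Qed.

Lemma Pt_indic t A x : measurable A -> Pt P t (fun y => (\1_A y)%:E) x = P t x A.
Proof. by move=> mA; rewrite /Pt integral_indic// setIT. Qed.

(** Invariance tested on indicators holds at each positive time and survives averaging over time. *)
Lemma resolvent_measure_invariant (nu : {finite_measure set T -> \bar R})
    (alpha : R) (alpha_gt0 : (0 < alpha)%R) A :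
  invariant_measure P nu -> measurable A ->
  resolvent_measure HP alpha_gt0 nu A = nu A.
Proof.
move=> [_ invnu] mA; apply: resolvent_measure_cst => // t t0.
transitivity (\int[nu]_x Pt P t (fun y => (\1_A y)%:E) x).
  by apply: eq_integral => x _; rewrite Pt_indic.
rewrite invnu//.
  by rewrite integral_indic// setIT.
by exists 1%R => x; rewrite indicE; case: (_ \in _); rewrite ?normr1 ?normr0.
Qed.

Lemma resolvent_kernel_le1 (alpha : R) (alpha_gt0 : (0 < alpha)%R) x A :
  measurable A -> resolvent_kernel HP alpha_gt0 x A <= 1.
Proof.
move=> mA; apply: (@le_trans _ _ (resolvent_kernel HP alpha_gt0 x setT)).
  by rewrite le_measure// inE.
rewrite resolvent_kernelE// -(integral_exponential_pdf alpha_gt0).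
rewrite le_eqVlt; apply/orP; left; apply/eqP.
by apply: eq_integral => s _; rewrite probability_setT mule1.
Qed.

Lemma rai_of_invariant (nu : {finite_measure set T -> \bar R}) :
  invariant_measure P nu -> nu `<< m -> resolvent_almost_invariant P m.
Proof.
move=> invnu num.
pose g := Radon_Nikodym_SigmaFinite.f nu m.
have g0 x : 0 <= g x by exact: Radon_Nikodym_SigmaFinite.f_ge0.
have gfin x : g x \is a fin_num by exact: Radon_Nikodym_SigmaFinite.f_fin_num.
have mg : measurable_fun setT g.
  by apply: (measurable_int m); exact: Radon_Nikodym_SigmaFinite.f_integrable.
(* With [K] the resolvent kernel of [A], [0 <= K <= 1] gives [K <= g K + u] pointwise; the first
   term integrates to [nu A] by invariance. *)
pose v x := mine (g x) 1; pose u x := 1 - v x.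
have v0 x : 0 <= v x by rewrite le_min g0 lee01.
have vfin x : v x \is a fin_num.
  by rewrite ge0_fin_numE// (@le_lt_trans _ _ 1)// ?ge_min ?lexx ?orbT// ltry.
have u0 x : 0 <= u x by rewrite sube_ge0 ?vfin// ge_min lexx orbT.
have mv : measurable_fun setT v by exact: measurable_mine.
have mu : measurable_fun setT u by apply: emeasurable_funB.
have uv : \int[m]_x u x + \int[m]_x v x = m setT.
  rewrite -ge0_integralD// -[RHS]mul1e -integral_cst//.
  by apply: eq_integral => x _; rewrite /u subeK// vfin.
(* If [min(g, 1)] had integral zero, then [g] would vanish almost everywhere and [nu] would be zero.
   This strict positivity is what gives [delta < 1]. *)
have vpos : 0 < \int[m]_x v x.
  rewrite lt_neqAle integral_ge0// andbT eq_sym; apply/eqP => v_eq0.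
  have : ae_eq m setT v (cst 0).
    apply/ae_eq_integral_abs => //.
    by rewrite -[RHS]v_eq0; apply: eq_integral => x _; rewrite gee0_abs.
  move=> vae; case: invnu => /eqP + _; apply.
  rewrite (@Radon_Nikodym_SigmaFinite.f_integral _ _ _ nu m num)//.
  rewrite -[RHS](integral0 m setT); apply: ae_eq_integral => //.
  apply: filterS vae => x vx _; have := vx Logic.I; rewrite /v /= minEle.
  by case: ifPn => // _ /eqP; rewrite onee_eq0.
have mfin : m setT \is a fin_num by exact: fin_num_measure.
have ufin : \int[m]_x u x \is a fin_num.
  rewrite ge0_fin_numE ?integral_ge0// (@le_lt_trans _ _ (m setT))//.
    by rewrite -uv leeDl// integral_ge0.
  by rewrite -ge0_fin_numE.
have M0 : (0 < fine (m setT))%R by rewrite fine_gt0// m_gt0 -ge0_fin_numE.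
have deltaE : (fine (\int[m]_x u x) / fine (m setT))%:E * m setT = \int[m]_x u x.
  rewrite -[X in _ * X](fineK mfin) -EFinM mulfVK ?gt_eqF//.
  by rewrite fineK.
(* [delta] is chosen so that [delta * m(E)] is the integral of [u], and [phi] is [nu] itself. *)
exists (fine (\int[m]_x u x) / fine (m setT))%R, (fun A => fine (nu A)); split.
- by rewrite divr_ge0// fine_ge0// integral_ge0.
- rewrite ltr_pdivrMr// mul1r fine_lt// -[X in _ < X]uv.
  by rewrite lteDl.
- by move=> A _; rewrite fine_ge0.
- move=> eps eps0.
  (* Absolute continuity in its epsilon-eta form is available for the variation of [nu] seen as a
     charge, and this variation dominates [nu]. *)
  have [Q [N QN]] := Hahn_decomposition (charge_of_finite_measure nu).
  have [eta [eta0 Heta]] := charge_variation_continuous QN num eps0.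
  exists eta; split=> // A mA mAeta; rewrite -lte_fin fineK ?fin_num_measure//.
  apply: le_lt_trans (Heta A mA mAeta).
  by apply: le_trans (abse_charge_variation QN mA); rewrite lee_abs.
- move=> A alpha mA alpha0; rewrite deltaE (m_aR_resolvent_measure HP alpha0)//.
  rewrite fineK ?fin_num_measure// -(resolvent_measure_invariant alpha0 invnu mA).
  pose K x := resolvent_kernel HP alpha0 x A.
  have mK : measurable_fun setT K by exact: measurable_resolvent_kernel.
  have -> : resolvent_measure HP alpha0 nu A = \int[nu]_x K x by [].
  rewrite -(Radon_Nikodym_SigmaFinite.change_of_variables num)// -/g.
  rewrite -ge0_integralD//; last 2 first.
  + by move=> x _; rewrite mule_ge0.
  + exact: emeasurable_funM.
  apply: ge0_le_integral => //.
  + by apply: emeasurable_funD => //; exact: emeasurable_funM.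
  move=> x _; rewrite -/(K x).
  have K0 : 0 <= K x by [].
  have K1 : K x <= 1 by exact: resolvent_kernel_le1.
  (* If [g > 1] then [u = 0] and [K <= K g]. If [g <= 1] then [u = 1 - g] and
     [K (1 - g) <= 1 - g]. *)
  rewrite /u /v; have [g1|g1] := leP (g x) 1; last first.
    by rewrite subee// adde0 lee_pemulr// ltW.
  have Kfin : K x \is a fin_num by rewrite ge0_fin_numE// (le_lt_trans K1)// ltry.
  move: K0 K1 g1 (g0 x); rewrite -(fineK Kfin) -(fineK (gfin x)).
  rewrite -EFinM -EFinB -EFinD !lee_fin => K0 K1 g1 g0'.
  by nra.
Qed.

Lemma c_const_of_rai : resolvent_almost_invariant P m ->
  exists alpha : nat -> R,
    [/\ (forall n, 0 < alpha n)%R,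
        (forall n k, (n <= k)%N -> (alpha k <= alpha n)%R),
        alpha @ \oo --> 0%R & c_const P m alpha < m setT].
Proof.
move=> [delta [phi [delta0 delta1 phi0 phic Hphi]]].
(* The bound is uniform in [alpha], so any sequence decreasing to [0] would serve. *)
exists (fun n => n.+1%:R^-1)%R; split.
- by move=> n; rewrite invr_gt0.
- by move=> n k nk; rewrite lef_pV2 ?posrE// ler_nat.
- exact: cvg_harmonic.
have mfin : m setT \is a fin_num by exact: fin_num_measure.
have M0 : (0 < fine (m setT))%R by rewrite fine_gt0// m_gt0 -ge0_fin_numE.
(* [e] is half of the gap [(1 - delta) * M], so [e + delta * M < M]. *)
pose M := fine (m setT); pose e := ((1 - delta) / 2 * M)%R.
have e0 : (0 < e)%R by rewrite mulr_gt0// divr_gt0// subr_gt0.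
have [eta [eta0 Heta]] := phic e e0.
rewrite c_constE -(fineK mfin) -/M.
apply: (@le_lt_trans _ _ (e + delta * M)%:E); last first.
  by move: e0; rewrite lte_fin /e; lra.
apply: le_trans.
  by apply: ereal_inf_lbound; exists eta.
apply: ge_ereal_sup => _ [A [mA Aeta] <-]; apply: ge_ereal_sup => _ [n _ <-].
apply: le_trans (Hphi A _ mA _) _; first by rewrite invr_gt0.
rewrite -(fineK mfin) -EFinM -EFinD lee_fin lerD2r ltW//.
exact: Heta.
Qed.

Lemma c_const_lt_bound alpha : c_const P m alpha < m setT ->
  exists c eps : R, [/\ (0 < eps)%R, (c < fine (m setT))%R &
    forall n A, measurable A -> m A < eps%:E -> m_aR P m (alpha n) A <= c%:E].
Proof.
rewrite c_constE => /ereal_inf_lt[_ [eps /= eps0 <-]] cM.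
have mfin : m setT \is a fin_num by exact: fin_num_measure.
(* The maximum with [0] is nonnegative by construction, so lying below the finite [m setT] makes it
   a real number. *)
have {cM} : maxe 0 (c_sup alpha eps) < m setT by rewrite gt_max m_gt0.
set s := maxe _ _ => sM.
have sfin : s \is a fin_num.
  by rewrite ge0_fin_numE ?le_max ?lexx// (lt_trans sM)// -ge0_fin_numE.
exists (fine s), eps; split => //; first exact: fine_lt.
move=> n A mA Aeps; rewrite fineK// le_max; apply/orP; right.
apply: le_trans (ereal_sup_ubound _); last by exists A.
by apply: ereal_sup_ubound; exists n.
Qed.

(* A sub-invariant finite measure has [nu P_t] and [nu] of equal mass. *)
Lemma invariant_of_subinvariant (nu : {finite_measure set T -> \bar R}) :
  nu setT != 0 ->
  (forall t A, (0 < t)%R -> measurable A -> \int[nu]_x P t x A <= nu A) ->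
  invariant_measure P nu.
Proof.
move=> nu0 sub; split=> // t f t0 mf [C fC].
have mP A : measurable A -> measurable_fun setT (fun x => P t x A).
  by move=> mA; apply: (measurable_transition HP) => //; exact: ltW.
(* The inequalities for [A] and its complement add up to an equality of total masses, so both are
   equalities. *)
have eqnu A : measurable A -> \int[nu]_x P t x A = nu A.
  move=> mA; have mCA := measurableC mA.
  have nufin B : measurable B -> nu B \is a fin_num by exact: fin_num_measure.
  have Pfin B : measurable B -> \int[nu]_x P t x B \is a fin_num.
    move=> mB; rewrite ge0_fin_numE ?integral_ge0//.
    by rewrite (le_lt_trans (sub t B t0 mB))// -ge0_fin_numE ?nufin.
  have : \int[nu]_x P t x A + \int[nu]_x P t x (~` A) = nu A + nu (~` A).
    rewrite -ge0_integralD//; try exact: mP.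
    transitivity (\int[nu]_x cst 1 x).
      apply: eq_integral => x _.
      by rewrite /= -(@probability_setT _ _ _ (P t x)) -(setUCr A) measureU// setICr.
    by rewrite integral_cst// mul1e -[in LHS](setUCr A) measureU// setICr.
  have := sub t A t0 mA; have := sub t _ t0 mCA.
  rewrite -(fineK (nufin A mA)) -(fineK (nufin _ mCA)).
  rewrite -(fineK (Pfin A mA)) -(fineK (Pfin _ mCA)).
  rewrite -!EFinD !lee_fin => a b [] ab; congr EFin; lra.
have Cge0 : (0 <= C)%R by apply: le_trans (fC point).
(* Adding [C] makes the integrand nonnegative, as the composition formula requires; all measures
   here are finite, so [C] can be subtracted afterwards. *)
have fC0 x : (0 <= f x + C)%R.
  by have := fC x; rewrite ler_norml => /andP[]; lra.
have mfC : measurable_fun setT (fun x => (f x + C)%:E).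
  by apply/measurable_EFinP; exact: measurable_funD.
have intf (la : {finite_measure set T -> \bar R}) : la.-integrable setT (EFin \o f).
  apply: (@le_integrable _ _ _ la setT measurableT _ (cst C%:E)) => //.
  - exact/measurable_EFinP.
  - by move=> x _ /=; rewrite lee_fin (ger0_norm Cge0).
  - exact: finite_measure_integrable_cst.
have intfC (la : {finite_measure set T -> \bar R}) :
    \int[la]_x (f x + C)%:E = \int[la]_x (f x)%:E + C%:E * la setT.
  transitivity (\int[la]_x ((EFin \o f) x + cst C%:E x)); first exact: eq_integral.
  rewrite integralD//; [|exact: intf|exact: finite_measure_integrable_cst].
  by rewrite integral_cst.
have PtC x : Pt P t (fun y => (f y)%:E) x = \int[P t x]_y (f y + C)%:E - C%:E.
  by rewrite intfC [X in _ * X](@probability_setT _ _ _ (P t x)) mule1 addeK.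
have mPtC : measurable_fun setT (fun x => \int[P t x]_y (f y + C)%:E).
  by apply: measurable_fun_integral_kernel => // z; rewrite lee_fin.
have bindE : \int[nu]_x \int[P t x]_y (f y + C)%:E = \int[nu]_x (f x + C)%:E.
  rewrite -(@ge0_integral_mbind _ _ _ _ _ nu (P t) mP)//.
  by apply: eq_measure_integral => A mA _; exact: eqnu.
under eq_integral do rewrite PtC.
rewrite integralB//.
- rewrite bindE intfC integral_cst//.
  by rewrite addeK// fin_numM// fin_num_measure.
- apply/integrableP; split=> //.
  rewrite (eq_integral (fun x => \int[P t x]_y (f y + C)%:E)); last first.
    by move=> x _; rewrite gee0_abs// integral_ge0// => y _; rewrite lee_fin.
  rewrite bindE intfC -ge0_fin_numE; last first.
    by rewrite -intfC; apply: integral_ge0 => x _; rewrite lee_fin.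
  by rewrite fin_numD (integrable_fin_num measurableT (intf nu)) fin_numM// fin_num_measure.
- exact: finite_measure_integrable_cst.
Qed.

Hypothesis mnull : forall (t : R) (f : T -> \bar R), (0 < t)%R ->
  (forall x, 0 <= f x) -> measurable_fun setT f ->
  \int[m]_x f x = 0 -> \int[m]_x Pt P t f x = 0.

(** The null-set hypothesis, applied to the indicator of [A], gives zero at every positive time. *)
Lemma resolvent_measure_null (alpha : R) (alpha_gt0 : (0 < alpha)%R) A :
  measurable A -> m A = 0 -> resolvent_measure HP alpha_gt0 m A = 0.
Proof.
move=> mA mA0; apply: resolvent_measure_cst => // t t0.
rewrite -(@mnull t (fun y => (\1_A y)%:E) t0).
- by apply: eq_integral => x _; rewrite Pt_indic.
- by move=> x; rewrite lee_fin.
- by apply/measurable_EFinP; exact: measurable_indic.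
- by rewrite integral_indic// setIT.
Qed.

Lemma invariant_of_c_const (alpha : nat -> R) :
  (forall n, 0 < alpha n)%R -> alpha @ \oo --> 0%R -> c_const P m alpha < m setT ->
  exists nu : {finite_measure set T -> \bar R}, invariant_measure P nu /\ nu `<< m.
Proof.
move=> alpha_gt0 alpha0 /c_const_lt_bound[c [eps [eps0 cM Hc]]].
have mfin : m setT \is a fin_num by exact: fin_num_measure.
pose rho n := resolvent_measure HP (alpha_gt0 n) m.
have rhoT n : rho n setT = (fine (m setT))%:E.
  by rewrite fineK// /rho resolvent_measureT.
(* [G] refines the filter of cofinite sets, so ordinary limits remain limits along [G]. *)
have [G [UG ooG]] := ultraFilterLemma (@eventually_filter).
pose L := limit_content rhoT UG.
pose nu0 := lower_measure L.
have nu0fin : fin_num_fun nu0.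
  apply: lty_fin_num_fun; apply: (@le_lt_trans _ _ (L setT)).
    exact: lower_measure_le.
  by rewrite /L limit_contentT ltry.
pose nufin := Measure_isFinite.Build d T R nu0 nu0fin.
pose nu : {finite_measure set T -> \bar R} := HB.pack nu0 nufin.
exists nu; split; last first.
  apply: (lower_measure_dominates) => n A mA mA0.
  exact: resolvent_measure_null.
apply: invariant_of_subinvariant.
  apply: (@lower_measure_neq0 _ _ _ _ _ rhoT G UG m c eps) => //.
  by move=> n A mA Aeps; rewrite /rho -m_aR_resolvent_measure//; exact: Hc.
move=> t A t0 mA.
have mP B : measurable B -> measurable_fun setT (fun x => P t x B).
  by move=> mB; apply: (measurable_transition HP) => //; exact: ltW.
(* By maximality of [nu0] it is enough to bound the measure [nu0 P_t] by the content [L]. *)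
apply: (@lower_measure_max _ _ _ L (mbind nu0 mP)) => // B mB.
apply: (@integral_lower_measure_le _ _ _ _ _ rhoT G UG _
  (fun n => (expR (alpha n * t))%:E * rho n B)) => //.
- exact: mP.
- by move=> n; apply: integral_transition_resolvent_le => //; exact: ltW.
(* The factor from the time shift tends to [1], so the bounds converge to [L B] itself. *)
have expcvg : expR (alpha n * t)%R @[n --> \oo] --> (1%R : R).
  have -> : (1%R : R) = expR (0 * t)%R by rewrite mul0r expR0.
  by apply: continuous_cvg; [exact: continuous_expR|exact: cvgMr_tmp].
rewrite -[X in _ --> X]mul1e; apply: cvgeM => //; last exact: limit_content_cvg.
apply: cvg_EFin; first exact: nearW.
by move=> S /expcvg; exact: ooG.
Qed.

End invariant_measures.

Theorem theorem2p8 (d : measure_display) (T : measurableType d) (R : realType)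
  (P : R -> T -> probability T R) (m : {finite_measure set T -> \bar R}) :
  markov_transition_function P ->
  0 < m setT ->
  (forall (t : R) (f : T -> \bar R), (0 < t)%R ->
     (forall x, 0 <= f x) -> measurable_fun setT f ->
     \int[m]_x f x = 0 -> \int[m]_x Pt P t f x = 0) ->
  [<-> (exists nu : {finite_measure set T -> \bar R},
          invariant_measure P nu /\ nu `<< m);
       resolvent_almost_invariant P m;
       (exists alpha : nat -> R,
          [/\ (forall n, 0 < alpha n)%R,
              (forall n k, (n <= k)%N -> (alpha k <= alpha n)%R),
              alpha @ \oo --> 0%R &
              c_const P m alpha < m setT])].
Proof.
move=> HP m_gt0 mnull; tfae.
- by move=> [nu [invnu num]]; exact: rai_of_invariant invnu num.
- exact: c_const_of_rai.
- move=> [alpha [alpha_gt0 _ alpha0 calpha]].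
  exact: (invariant_of_c_const HP m_gt0 mnull alpha_gt0 alpha0 calpha).
Qed.
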